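(* In the setting described in the context, let $\gamma>0$ and $\breve\lambda=\min_{i=1,\dots,E}\lambda_i$. Then the approximation error $\|f_{\mathscr H}-f_\rho\|_{\mathscr{L}^2_{\rho_{\mathscr X}}}$ admits both of the following upper bounds: $$\text{(a)}\quad \|f_{\mathscr H}-f_\rho\|_{\mathscr{L}^2_{\rho_{\mathscr X}}}\le\frac{\gamma}{\breve\lambda+\gamma}\,\|\bar\alpha^\pi\|_2+\sqrt{\sum_{q\in\mathbb N\setminus Q}\bar\alpha_q^2},$$ $$\text{(b)}\quad \|f_{\mathscr H}-f_\rho\|_{\mathscr{L}^2_{\rho_{\mathscr X}}}\le\|\bar\alpha^\pi\|_\infty\,\gamma\sum_{i=1}^E\frac1{\lambda_i}+\sqrt{\sum_{q\in\mathbb N\setminus Q}\bar\alpha_q^2}.$$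
   Context: Input/output spaces and measure. Let $X>0$, $\mathscr X=[-X/2,X/2]\subset\mathbb R$, $\mathscr Y=\mathbb R$, $\mathscr Z=\mathscr X\times\mathscr Y$. Let $\rho$ be a probability measure on $\mathscr Z$ whose marginal $\rho_{\mathscr X}$ on $\mathscr X$ is uniform, $d\rho_{\mathscr X}(x)=d\mu(x)/X$ with $\mu$ the Lebesgue measure, and with conditional distributions $\rho(y|x)$ on $\mathbb R$. The regression function is $f_\rho(x)=\int_{\mathscr Y}y\,d\rho(y|x)$, assumed to belong to $\mathscr{L}^2_{\rho_{\mathscr X}}$, the space of square-integrable functions on $\mathscr X$ with norm $\|f\|_{\mathscr{L}^2_{\rho_{\mathscr X}}}=\big(\int_{\mathscr X}f(x)^2\,d\rho_{\mathscr X}(x)\big)^{1/2}$. Trigonometric expansion. $\mathbb N=\{1,2,\dots\}$. For $q\in\mathbb N$ put $\bar\varphi^s_q(x)=\sqrt2\sin(2\pi qx/X)$ and $\bar\varphi^c_q(x)=\sqrt2\cos(2\pi qx/X)$. The regression function is represented as $f_\rho=\sum_{q\in\mathbb N}(\bar\alpha^s_q\bar\varphi^s_q+\bar\alpha^c_q\bar\varphi^c_q)$ (convergence in $\mathscr{L}^2_{\rho_{\mathscr X}}$) with square-summable real coefficients. In compact notation, $\bar\alpha_q^2$ in a sum over $q$ stands for $(\bar\alpha_q^s)^2+(\bar\alpha_q^c)^2$. Hypothesis space. Let $E$ be a positive even integer, $Q=\{q_1,\dots,q_{E/2}\}\subset\mathbb N$ a set of $E/2$ distinct frequencies, and for $j=1,\dots,E/2$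 set $\varphi_j=\bar\varphi^s_{q_j}$, $\varphi_{j+E/2}=\bar\varphi^c_{q_j}$. The vector $\bar\alpha^\pi\in\mathbb R^E$ collects the corresponding coefficients of $f_\rho$: $\bar\alpha^\pi_j=\bar\alpha^s_{q_j}$ and $\bar\alpha^\pi_{j+E/2}=\bar\alpha^c_{q_j}$ for $j=1,\dots,E/2$. $\|\cdot\|_2$ and $\|\cdot\|_\infty$ are the Euclidean and maximum norms on $\mathbb R^E$. Let $\phi(x)=[\varphi_1(x),\dots,\varphi_E(x)]^\top$ and $\Sigma_\alpha=\mathrm{diag}(\lambda_1,\dots,\lambda_E)$ with all $\lambda_i>0$. The hypothesis space is $\mathscr H=\{f=\phi^\top(\cdot)\alpha:\alpha\in\mathbb R^E\}$ with norm $\|\phi^\top(\cdot)\alpha\|_{\mathscr H}^2=\alpha^\top\Sigma_\alpha^{-1}\alpha$ (the reproducing kernel Hilbert space of the kernel $\mathscr K(x_a,x_b)=\phi(x_a)^\top\Sigma_\alpha\phi(x_b)$). Data-free estimator. For $\gamma>0$, $$f_{\mathscr H}=\arg\min_{f\in\mathscr H}\ \int_{\mathscr X}(f(x)-f_\rho(x))^2\,d\rho_{\mathscr X}(x)+\gamma\|f\|_{\mathscr H}^2 .$$ *)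

(* Defs.v *)
From HB Require Import structures.
From mathcomp Require Import all_boot all_order all_algebra.
From mathcomp Require Import all_classical all_reals all_analysis.

Set Implicit Arguments.
Unset Strict Implicit.
Unset Printing Implicit Defensive.

Import Order.TTheory GRing.Theory Num.Theory.
Import numFieldNormedType.Exports.

Local Open Scope classical_set_scope.
Local Open Scope ring_scope.

(* The input space is a subset of R rather than a type of its own: a function
   on it is an f : R -> R whose values outside of [inputs X] are never used. *)
Definition inputs (R : realType) (X : R) : set R := `[- (X / 2), X / 2].

Section Measures.
Context (R : realType).
Local Notation RR := (measurableTypeR R).

Definition marginal (rho : probability (RR * RR)%type R) :
    probability RR R :=
  distribution rho (mfun_Sub (mem_set measurable_fst)).

(* In particular the marginal vanishes outside of [inputs X], so that rho is
   carried by the product of [inputs X] and R. *)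
Definition uniform_marginal (X : R) (rho : probability (RR * RR)%type R) :=
  forall A : set RR, measurable A ->
    marginal rho A = ((X^-1)%:E * lebesgue_measure (A `&` inputs X))%E.

(* [k x] is the conditional distribution rho(y|x). *)
Definition conditional_distribution (rho : probability (RR * RR)%type R)
    (k : R.-pker RR ~> RR) :=
  forall A B : set RR, measurable A -> measurable B ->
    rho (A `*` B) = (\int[marginal rho]_(x in A) k x B)%E.

Definition has_conditional_mean (X : R) (rho : probability (RR * RR)%type R)
    (k : R.-pker RR ~> RR) :=
  {ae marginal rho, forall x, inputs X x ->
    (k x).-integrable setT (EFin \o (id : RR -> R))}.

Definition regression (k : R.-pker RR ~> RR) (x : R) : R := \int[k x]_y y.

Definition square_integrable (X : R) (nu : probability RR R) (f : R -> R) :=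
  measurable_fun (inputs X : set RR) (f : RR -> RR) /\
  (\int[nu]_(x in inputs X) (f x ^+ 2)%:E < +oo)%E.

Definition sqnorm2 (X : R) (nu : probability RR R) (f : R -> R) : R :=
  \int[nu]_(x in inputs X) (f x ^+ 2).

Definition norm2 (X : R) (nu : probability RR R) (f : R -> R) : R :=
  Num.sqrt (sqnorm2 X nu f).

End Measures.

Definition sinq (R : realType) (X : R) (q : nat) (x : R) : R :=
  Num.sqrt 2 * sin (2 * pi * q%:R * x / X).

Definition cosq (R : realType) (X : R) (q : nat) (x : R) : R :=
  Num.sqrt 2 * cos (2 * pi * q%:R * x / X).

(* Frequencies are q >= 1; the values of [als] and [alc] at 0 are never used. *)
Definition fourier_sum (R : realType) (X : R) (als alc : nat -> R) (n : nat)
    (x : R) : R :=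
  \sum_(1 <= q < n.+1) (als q * sinq X q x + alc q * cosq X q x).

(* The finite-dimensional feature space has dimension E = m + m, with the m
   sines first and the m cosines (at the same frequencies) second. *)
Definition features (R : realType) (X : R) (m : nat) (freq : 'I_m -> nat)
    (x : R) : 'cV[R]_(m + m) :=
  col_mx (\col_j sinq X (freq j) x) (\col_j cosq X (freq j) x).

Definition coeffs (R : realType) (als alc : nat -> R) (m : nat)
    (freq : 'I_m -> nat) : 'cV[R]_(m + m) :=
  col_mx (\col_j als (freq j)) (\col_j alc (freq j)).

Definition euclid (R : realType) (n : nat) (v : 'cV[R]_n) : R :=
  Num.sqrt (\sum_i v i 0 ^+ 2).

Definition max_norm (R : realType) (n : nat) (v : 'cV[R]_n) : R :=
  \big[Num.max/0]_i `|v i 0|.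

Definition represents (R : realType) (X : R) (m : nat) (freq : 'I_m -> nat)
    (f : R -> R) (a : 'cV[R]_(m + m)) :=
  forall x, inputs X x -> f x = ((features X freq x)^T *m a) 0 0.

Definition hypothesis_space (R : realType) (X : R) (m : nat)
    (freq : 'I_m -> nat) : set (R -> R) :=
  [set f | exists a, represents X freq f a].

(* For 0 < X and distinct positive frequencies, the features are linearly
   independent on [inputs X]: the vector chosen below is the only one that
   represents f, so that the norm is well defined on the hypothesis space. *)
Definition hypothesis_sqnorm (R : realType) (X : R) (m : nat)
    (freq : 'I_m -> nat) (lam : 'rV[R]_(m + m)) (f : R -> R) : R :=
  let a := xget 0 [set a | represents X freq f a] in
  (a^T *m invmx (diag_mx lam) *m a) 0 0.

Definition penalized_risk (R : realType) (X : R)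
    (nu : probability (measurableTypeR R) R) (m : nat) (freq : 'I_m -> nat)
    (lam : 'rV[R]_(m + m)) (gam : R) (f0 f : R -> R) : R :=
  sqnorm2 X nu (f \- f0) + gam * hypothesis_sqnorm X freq lam f.

Definition is_estimator (R : realType) (X : R)
    (nu : probability (measurableTypeR R) R) (m : nat) (freq : 'I_m -> nat)
    (lam : 'rV[R]_(m + m)) (gam : R) (f0 f : R -> R) :=
  hypothesis_space X freq f /\
  forall g, hypothesis_space X freq g ->
    penalized_risk X nu freq lam gam f0 f <=
    penalized_risk X nu freq lam gam f0 g.

(* Main.v *)
Require Import Defs.
From HB Require Import structures.
From mathcomp Require Import all_boot all_order all_algebra.
From mathcomp Require Import all_classical all_reals all_analysis.
From mathcomp Require Import measurable_realfun ring.

Set Implicit Arguments.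
Unset Strict Implicit.
Unset Printing Implicit Defensive.

Import Order.TTheory GRing.Theory Num.Theory.
Import numFieldNormedType.Exports.

Local Open Scope classical_set_scope.
Local Open Scope ring_scope.

(** Under the uniform distribution on [-X/2, X/2] the functions sinq q and
    cosq q, for q > 0, are orthonormal (Rintegral_sinq_sinq,
    Rintegral_cosq_cosq, Rintegral_sinq_cosq). Hence every quantity in the risk
    is a function of coefficients: for f in the hypothesis space with
    coefficient vector a, and f0 the regression function with coefficients
    alpha at the chosen frequencies,
      |f - f0|^2 = \sum_i (a_i - alpha_i)^2 + T,
    where T is the energy of f0 at the other frequencies (sqnorm2_modelB).
    This Pythagorean identity is the limit of the same identity for the partial
    Fourier sums of f0, where it is the Parseval identity of a trigonometric
    polynomial (sqnorm2_fourier_sum); Minkowski's inequality justifies the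
    passage to the limit (cvg_norm2).

    The penalized risk is then T plus a sum of one quadratic per coordinate,
      (a_i - alpha_i)^2 + gamma a_i^2 / lambda_i,
    whose only minimizer is a_i = lambda_i alpha_i / (lambda_i + gamma)
    (estimator_coeffs). So the estimator misses alpha_i by
    gamma alpha_i / (lambda_i + gamma), and the error is exactly
      sqrt (\sum_i (gamma alpha_i / (lambda_i + gamma))^2 + T)
    (norm2_estimatorB). Both bounds split off sqrt T by subadditivity of the
    square root; (a) then bounds lambda_i below by the smallest weight, and (b)
    bounds the Euclidean norm by the sum of the absolute values, and
    lambda_i + gamma below by lambda_i. *)

(** * The norm of square-integrable functions *)

Section L2norm.
Context (R : realType) (X : R) (nu : probability (measurableTypeR R) R).
Local Notation D := (inputs X).
Implicit Types f g : R -> R.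

Lemma measurable_inputs : measurable (D : set (measurableTypeR R)).
Proof. exact: measurable_itv. Qed.

(** Lnorm integrates over the whole line: extending a function by
    0 outside of the inputs gives access to Minkowski's inequality. *)
Lemma Lnorm2_restrict f :
  ('N[nu]_2%:E[EFin \o (f \_ D)] =
   (\int[nu]_(x in D) (f x ^+ 2)%:E) `^ 2^-1)%E.
Proof.
rewrite unlock [in RHS]integral_mkcond; congr (_ `^ _)%E.
apply: eq_integral => x _ /=.
rewrite powR_mulrn// real_normK ?num_real// !patchE.
by case: ifP => //; rewrite expr0n.
Qed.

Lemma norm2E f : square_integrable X nu f ->
  ((norm2 X nu f)%:E = 'N[nu]_2%:E[EFin \o (f \_ D)])%E.
Proof.
move=> [mf foo]; rewrite Lnorm2_restrict /norm2 /sqnorm2 /Rintegral.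
have : (0 <= \int[nu]_(x in D) (f x ^+ 2)%:E)%E.
  by apply: integral_ge0 => x _; rewrite lee_fin sqr_ge0.
case: (integral _ _ _) foo => [r _ /=| |]//.
by rewrite lee_fin => r0; rewrite powR12_sqrt.
Qed.

Lemma measurable_restrict_inputs f : square_integrable X nu f ->
  measurable_fun [set: measurableTypeR R] (f \_ D : R -> measurableTypeR R).
Proof.
move=> [mf _].
exact/(measurable_restrictT (f : R -> measurableTypeR R) measurable_inputs).
Qed.

Lemma restrictD_inputs f g : (f \+ g) \_ D = ((f \_ D) \+ (g \_ D))%R.
Proof. by apply/funext => x; rewrite /= !patchE; case: ifP; rewrite ?addr0. Qed.

Lemma square_integrableD f g : square_integrable X nu f ->
  square_integrable X nu g -> square_integrable X nu (f \+ g).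
Proof.
move=> sf sg; split; first exact: (measurable_funD sf.1 sg.1).
apply: (@lty_poweRy _ _ 2^-1) => //.
rewrite -Lnorm2_restrict restrictD_inputs.
apply: (le_lt_trans (minkowski_EFin nu (measurable_restrict_inputs sf)
  (measurable_restrict_inputs sg) _)); first by rewrite ler1n.
by rewrite -!norm2E// lte_add_pinfty ?ltry.
Qed.

Lemma ler_norm2D f g : square_integrable X nu f -> square_integrable X nu g ->
  norm2 X nu (f \+ g) <= norm2 X nu f + norm2 X nu g.
Proof.
move=> sf sg; rewrite -lee_fin EFinD !norm2E//; last exact: square_integrableD.
rewrite restrictD_inputs; apply: minkowski_EFin; last by rewrite ler1n.
- exact: measurable_restrict_inputs.
- exact: measurable_restrict_inputs.
Qed.

Lemma square_integrableN f : square_integrable X nu f ->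
  square_integrable X nu (\- f).
Proof.
move=> [mf foo]; split; first exact: measurableT_comp.
by under eq_integral do rewrite /= sqrrN.
Qed.

Lemma square_integrableB f g : square_integrable X nu f ->
  square_integrable X nu g -> square_integrable X nu (f \- g).
Proof. by move=> sf sg; apply: (square_integrableD sf (square_integrableN sg)). Qed.

Lemma sqnorm2_ge0 f : 0 <= sqnorm2 X nu f.
Proof. by apply: Rintegral_ge0 => x _; exact: sqr_ge0. Qed.

Lemma norm2_sqr f : norm2 X nu f ^+ 2 = sqnorm2 X nu f.
Proof. by rewrite sqr_sqrtr// sqnorm2_ge0. Qed.

Lemma norm2N f : norm2 X nu (\- f) = norm2 X nu f.
Proof. by congr Num.sqrt; apply: eq_Rintegral => x _; rewrite /= sqrrN. Qed.

Lemma eq_norm2 f g : (forall x, D x -> f x = g x) ->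
  norm2 X nu f = norm2 X nu g.
Proof. by move=> fg; congr Num.sqrt; apply: eq_Rintegral => x /set_mem/fg ->. Qed.

Lemma continuous_integrable_inputs f : continuous f ->
  nu.-integrable D (EFin \o f).
Proof.
move=> cf; apply: measurable_bounded_integrable.
- exact: measurable_inputs.
- by rewrite (le_lt_trans (probability_le1 _ measurable_inputs))// ltry.
- by apply: measurable_funTS; exact: continuous_measurable_fun.
- have /compact_bounded[M [_ Mf]] :=
    continuous_compact (continuous_subspaceT cf)
      (@segment_compact _ (- (X / 2)) (X / 2)).
  exists M; split; rewrite ?num_real //= => y My x xD; apply: (Mf y My).
  by exists x.
Qed.

Lemma continuous_square_integrable f : continuous f -> square_integrable X nu f.
Proof.
move=> cf; split; first by apply: measurable_funTS; exact: continuous_measurable_fun.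
have cf2 : continuous (fun x => f x ^+ 2).
  by move=> x; under eq_fun do rewrite expr2; exact: cvgM (cf x) (cf x).
have /integrableP[_] := continuous_integrable_inputs cf2.
by under eq_integral do rewrite /= ger0_norm ?sqr_ge0//.
Qed.

(** The distance to g is 1-Lipschitz for the norm, so distances to f are limits
    of distances to any sequence that converges to f. *)
Lemma cvg_norm2 f (S : nat -> R -> R) : square_integrable X nu f ->
  (forall n, square_integrable X nu (S n)) ->
  norm2 X nu (f \- S n) @[n --> \oo] --> (0 : R) ->
  forall g, square_integrable X nu g ->
  norm2 X nu (g \- S n) @[n --> \oo] --> norm2 X nu (g \- f).
Proof.
move=> sf sS fS g sg.
apply/cvgrPdist_le => e e0.
have : \forall n \near \oo, `|0 - norm2 X nu (f \- S n)| <= e.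
  by move/cvgrPdist_le : fS; apply.
apply: filterS => n; rewrite sub0r normrN ger0_norm ?sqrtr_ge0// => le_e.
apply: le_trans le_e; rewrite ler_norml; apply/andP; split.
- rewrite lerBrDr addrC lerBlDr.
  rewrite [leLHS](@eq_norm2 _ ((g \- f) \+ (f \- S n))); last first.
    by move=> x _ /=; rewrite addrA subrK.
  by rewrite ler_norm2D//; exact: square_integrableB.
- rewrite lerBlDr addrC.
  rewrite [leLHS](@eq_norm2 _ ((g \- S n) \+ \- (f \- S n))); last first.
    by move=> x _ /=; rewrite opprB addrA subrK.
  rewrite -[X in _ <= _ + X]norm2N.
  rewrite ler_norm2D//; last apply: square_integrableN; exact: square_integrableB.
Qed.

End L2norm.

(** * Orthonormality of the trigonometric system *)

Definition uniform_on_inputs (R : realType) (X : R)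
    (nu : probability (measurableTypeR R) R) :=
  forall A : set (measurableTypeR R), measurable A ->
    nu A = ((X^-1)%:E * lebesgue_measure (A `&` inputs X))%E.

Section UniformInput.
Context (R : realType) (X : R) (X0 : 0 < X).
Context (nu : probability (measurableTypeR R) R).
Hypothesis nu_uniform : uniform_on_inputs X nu.
Local Notation D := (inputs X).
Implicit Types f g : R -> R.

Lemma integral_uniform_ge0 f : continuous f -> (forall x, 0 <= f x) ->
  (\int[nu]_(x in D) (f x)%:E =
   (X^-1)%:E * \int[lebesgue_measure]_(x in D) (f x)%:E)%E.
Proof.
move=> cf f0.
have Xi : 0 <= X^-1 by rewrite invr_ge0 ltW.
rewrite (eq_measure_integral (mscale (NngNum Xi) lebesgue_measure)); last first.
  by move=> A mA AD; have := nu_uniform mA; rewrite setIidl.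
rewrite ge0_integral_mscale//.
- exact: measurable_inputs.
- by apply/measurable_EFinP/measurable_funTS; exact: continuous_measurable_fun.
- by move=> x _; rewrite lee_fin.
Qed.

Lemma Rintegral_uniform f : continuous f ->
  \int[nu]_(x in D) f x = X^-1 * \int[lebesgue_measure]_(x in D) f x.
Proof.
move=> cf.
have intL (h : R -> R) : continuous h -> (@lebesgue_measure R).-integrable D (EFin \o h).
  move=> ch; apply: continuous_compact_integrable; first exact: segment_compact.
  exact: continuous_subspaceT.
have ge0 (h : R -> R) : continuous h -> (forall x, 0 <= h x) ->
    \int[nu]_(x in D) h x = X^-1 * \int[lebesgue_measure]_(x in D) h x.
  move=> ch h0; rewrite /Rintegral integral_uniform_ge0// fineM//.
  by apply: integrable_fin_num; [exact: measurable_inputs|exact: intL].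
(* Scaling of the measure goes through integrals of nonnegative functions, so
   f is written as the difference of f + |f| and |f|. *)
have cn : continuous (fun x => `|f x| : R).
  by move=> x; apply: cvg_norm; exact: cf.
have cfn : continuous (fun x => f x + `|f x| : R).
  by move=> x; apply: cvgD; [exact: cf|exact: cn].
have fE (m : {measure set (measurableTypeR R) -> \bar R}) :
    \int[m]_(x in D) f x = \int[m]_(x in D) ((f x + `|f x|) - `|f x|).
  by apply: eq_Rintegral => x _; rewrite addrK.
rewrite !fE !RintegralB//; try exact: measurable_inputs.
- rewrite !ge0// ?mulrBr// => x.
  by rewrite -lerBlDr sub0r lerNl -normrN ler_norm.
- exact: intL.
- exact: intL.
- exact: continuous_integrable_inputs.
- exact: continuous_integrable_inputs.
Qed.

Lemma Rintegral_uniform_FTC2 f (F : R -> R) : continuous f ->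
  (forall x : R, is_derive x (1 : R) F (f x)) ->
  \int[nu]_(x in D) f x = X^-1 * (F (X / 2) - F (- (X / 2))).
Proof.
move=> cf dF; rewrite Rintegral_uniform//; congr (_ * _).
have cF : continuous F.
  by move=> x; apply: differentiable_continuous; apply/derivable1_diffP; case: (dF x).
rewrite /Rintegral (@continuous_FTC2 _ f F)//.
- by rewrite gtrN// divr_gt0.
- exact: continuous_subspaceT.
- split; first by move=> x _; case: (dF x).
  + by apply: cvg_at_right_filter; exact: cF.
  + by apply: cvg_at_left_filter; exact: cF.
- by move=> x _; rewrite derive1E; case: (dF x).
Qed.


Lemma continuous_sin_freq (a r : R) : continuous (fun x : R => a * sin (r * x)).
Proof.
move=> x; apply: cvgM; first exact: cvg_cst.
apply: (continuous_comp (f := fun x : R => r * x)); last exact: continuous_sin.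
by apply: cvgM; [exact: cvg_cst|exact: cvg_id].
Qed.

Lemma continuous_cos_freq (a r : R) : continuous (fun x : R => a * cos (r * x)).
Proof.
move=> x; apply: cvgM; first exact: cvg_cst.
apply: (continuous_comp (f := fun x : R => r * x)); last exact: continuous_cos.
by apply: cvgM; [exact: cvg_cst|exact: cvg_id].
Qed.

Lemma is_derive_sin_freq (a r x : R) :
  is_derive x (1 : R) (fun x : R => a * sin (r * x)) (a * r * cos (r * x)).
Proof.
by apply: is_derive_eq; rewrite /GRing.scale /= mulr1; ring.
Qed.

Lemma is_derive_cos_freq (a r x : R) :
  is_derive x (1 : R) (fun x : R => a * cos (r * x)) (- (a * r) * sin (r * x)).
Proof.
by apply: is_derive_eq; rewrite /GRing.scale /= mulr1; ring.
Qed.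

Lemma Rintegral_cos_freq (r : R) : r != 0 ->
  \int[nu]_(x in D) cos (r * x) = 2 * sin (r * (X / 2)) / (r * X).
Proof.
move=> r0.
have dF x : is_derive x (1 : R) (fun x : R => r^-1 * sin (r * x)) (1 * cos (r * x)).
  by apply: is_derive_eq (is_derive_sin_freq _ _ _) _; rewrite mulVf.
have := Rintegral_uniform_FTC2 (@continuous_cos_freq 1 r) dF.
under eq_Rintegral do rewrite mul1r.
by move=> ->; rewrite mulrN sinN; field; rewrite r0 gt_eqF.
Qed.

Lemma Rintegral_sin_freq (r : R) : \int[nu]_(x in D) sin (r * x) = 0.
Proof.
have [->|r0] := eqVneq r 0.
  under eq_Rintegral do rewrite mul0r sin0.
  by rewrite Rintegral_cst ?mul0r//; exact: measurable_inputs.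
have dF x : is_derive x (1 : R) (fun x : R => - r^-1 * cos (r * x)) (1 * sin (r * x)).
  by apply: is_derive_eq (is_derive_cos_freq _ _ _) _; rewrite (mulNr r^-1) mulVf// opprK.
have := Rintegral_uniform_FTC2 (@continuous_sin_freq 1 r) dF.
under eq_Rintegral do rewrite mul1r.
by move=> ->; rewrite mulrN cosN subrr mulr0.
Qed.


Lemma sin_pi_nat (n : nat) : sin (pi * n%:R) = 0 :> R.
Proof.
by elim: n => [|n IH]; rewrite ?mulr0 ?sin0// -natr1 mulrDr mulr1 sinDpi IH oppr0.
Qed.

Local Notation w q := (2 * pi * q%:R / X).

Lemma sinqE q x : sinq X q x = Num.sqrt 2 * sin (w q * x).
Proof. by congr (_ * sin _); rewrite mulrAC. Qed.

Lemma cosqE q x : cosq X q x = Num.sqrt 2 * cos (w q * x).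
Proof. by congr (_ * cos _); rewrite mulrAC. Qed.

Lemma continuous_sinq q : continuous (sinq X q).
Proof. by rewrite (funext (sinqE q)); exact: continuous_sin_freq. Qed.

Lemma continuous_cosq q : continuous (cosq X q).
Proof. by rewrite (funext (cosqE q)); exact: continuous_cos_freq. Qed.

(** The sum of two frequencies is a nonzero multiple of the fundamental one, so
    the cosine runs through whole periods over the inputs. *)
Lemma Rintegral_cosD p q : (0 < p)%N ->
  \int[nu]_(x in D) cos ((w p + w q) * x) = 0.
Proof.
move=> p0.
have wE : w p + w q = 2 * pi * (p + q)%:R / X.
  by rewrite natrD; field; rewrite gt_eqF.
have wn0 : w p + w q != 0.
  rewrite wE !mulf_neq0 ?invr_eq0 ?gt_eqF ?pi_gt0// ?ltr0n.
  by rewrite addn_gt0 p0.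
rewrite Rintegral_cos_freq// wE (_ : _ * (X / 2) = pi * (p + q)%:R); last first.
  by field; rewrite gt_eqF.
by rewrite sin_pi_nat mulr0 mul0r.
Qed.

Lemma Rintegral_cosB p q :
  \int[nu]_(x in D) cos ((w p - w q) * x) = (p == q)%:R.
Proof.
have [->|pq] := eqVneq p q.
  under eq_Rintegral do rewrite subrr mul0r cos0.
  rewrite Rintegral_cst ?mul1r; last exact: measurable_inputs.
  transitivity (fine ((X^-1)%:E * lebesgue_measure (D `&` D))%E).
    by congr fine; exact: nu_uniform (@measurable_inputs _ X).
  rewrite setIid /inputs lebesgue_measure_itv/= lte_fin gtrN ?divr_gt0//.
  by rewrite /= opprK -splitr mulVf// gt_eqF.
have wE : w p - w q = 2 * pi * (p%:R - q%:R) / X by field; rewrite gt_eqF.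
rewrite Rintegral_cos_freq; last first.
  by rewrite wE !mulf_neq0 ?invr_eq0 ?subr_eq0 ?eqr_nat// gt_eqF ?pi_gt0.
rewrite wE (_ : _ * (X / 2) = pi * p%:R - pi * q%:R); last first.
  by field; rewrite gt_eqF.
by rewrite sinB !sin_pi_nat !(mulr0, mul0r, subr0).
Qed.

Let sqrt2M (a b : R) : Num.sqrt 2 * a * (Num.sqrt 2 * b) = 2 * (a * b).
Proof. by rewrite mulrACA -expr2 sqr_sqrtr. Qed.

Let intcos (r : R) : nu.-integrable D (EFin \o (fun x => cos (r * x))).
Proof.
apply: continuous_integrable_inputs => x.
apply: (continuous_comp (f := fun x : R => r * x)); last exact: continuous_cos.
by apply: cvgM; [exact: cvg_cst|exact: cvg_id].
Qed.

Let intsin (r : R) : nu.-integrable D (EFin \o (fun x => sin (r * x))).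
Proof.
apply: continuous_integrable_inputs => x.
apply: (continuous_comp (f := fun x : R => r * x)); last exact: continuous_sin.
by apply: cvgM; [exact: cvg_cst|exact: cvg_id].
Qed.

(** The product-to-sum formulas reduce products of two waves to single waves at
    the sum and at the difference of their frequencies; the factor sqrt 2
    cancels the 1/2 in these formulas. *)
Lemma Rintegral_sinq_sinq p q : (0 < p)%N ->
  \int[nu]_(x in D) (sinq X p x * sinq X q x) = (p == q)%:R.
Proof.
move=> p0; rewrite -Rintegral_cosB -[RHS]subr0 -(Rintegral_cosD q p0) -RintegralB//.
- apply: eq_Rintegral => x _; rewrite !sinqE sqrt2M mulrBl.
  rewrite [(w p + w q) * x]mulrDl cosB cosD; ring.
- exact: measurable_inputs.
Qed.

Lemma Rintegral_cosq_cosq p q : (0 < p)%N ->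
  \int[nu]_(x in D) (cosq X p x * cosq X q x) = (p == q)%:R.
Proof.
move=> p0; rewrite -Rintegral_cosB -[RHS]addr0 -(Rintegral_cosD q p0) -RintegralD//.
- apply: eq_Rintegral => x _; rewrite !cosqE sqrt2M mulrBl.
  rewrite [(w p + w q) * x]mulrDl cosB cosD; ring.
- exact: measurable_inputs.
Qed.

Lemma Rintegral_sinq_cosq p q :
  \int[nu]_(x in D) (sinq X p x * cosq X q x) = 0.
Proof.
transitivity (\int[nu]_(x in D) (sin ((w p + w q) * x) + sin ((w p - w q) * x))).
  apply: eq_Rintegral => x _; rewrite sinqE cosqE sqrt2M mulrBl.
  by rewrite [(w p + w q) * x]mulrDl sinB sinD; ring.
rewrite RintegralD ?Rintegral_sin_freq ?addr0//.
exact: measurable_inputs.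
Qed.

End UniformInput.

(** * Parseval identity of trigonometric polynomials *)

Section Parseval.
Context (R : realType) (X : R).
Context (nu : probability (measurableTypeR R) R).
Local Notation D := (inputs X).

Lemma continuous_bigsum (I : Type) (r : seq I) (F : I -> R -> R) :
  (forall i, continuous (F i)) -> continuous (fun x => \sum_(i <- r) F i x).
Proof.
move=> cF; elim: r => [|i r IH] x.
  by under eq_fun do rewrite big_nil; exact: cvg_cst.
by under eq_fun do rewrite big_cons; apply: cvgD; [exact: cF|exact: IH].
Qed.

Lemma Rintegral_bigsum (I : Type) (r : seq I) (F : I -> R -> R) :
  (forall i, continuous (F i)) ->
  \int[nu]_(x in D) (\sum_(i <- r) F i x) = \sum_(i <- r) \int[nu]_(x in D) F i x.
Proof.
move=> cF; elim: r => [|i r IH].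
  under eq_Rintegral do rewrite big_nil.
  by rewrite big_nil Rintegral_cst ?mul0r//; exact: measurable_inputs.
under eq_Rintegral do rewrite big_cons.
rewrite big_cons -IH RintegralD//; first exact: measurable_inputs.
- exact: continuous_integrable_inputs.
- by apply: continuous_integrable_inputs; exact: continuous_bigsum.
Qed.

Lemma sqnorm2_orthonormal (I : finType) (e : I -> R -> R) (c : I -> R) :
  (forall i, continuous (e i)) ->
  (forall i j, \int[nu]_(x in D) (e i x * e j x) = (i == j)%:R) ->
  sqnorm2 X nu (fun x => \sum_i c i * e i x) = \sum_i c i ^+ 2.
Proof.
move=> ce orth.
have cee i j : continuous (fun x => e i x * e j x).
  by move=> x; apply: cvgM; exact: ce.
have ccee i j : continuous (fun x => c i * c j * (e i x * e j x)).
  by move=> x; apply: cvgM; [exact: cvg_cst|exact: cee].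
rewrite /sqnorm2.
transitivity (\int[nu]_(x in D) \sum_i \sum_j c i * c j * (e i x * e j x)).
  apply: eq_Rintegral => x _; rewrite expr2 mulr_suml; apply: eq_bigr => i _.
  by rewrite mulr_sumr; apply: eq_bigr => j _; rewrite mulrACA.
rewrite Rintegral_bigsum; last by move=> i; exact: continuous_bigsum.
apply: eq_bigr => i _; rewrite Rintegral_bigsum// (bigD1 i)//= big1 ?addr0.
- rewrite RintegralZl ?orth ?eqxx ?mulr1//; first exact: measurable_inputs.
  exact: continuous_integrable_inputs.
- move=> j ji; rewrite RintegralZl ?orth; last 2 first.
  + exact: measurable_inputs.
  + exact: continuous_integrable_inputs.
  by rewrite eq_sym (negbTE ji) mulr0.
Qed.

Hypotheses (X0 : 0 < X) (nu_uniform : uniform_on_inputs X nu).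

Let wave n (i : 'I_n + 'I_n) : R -> R :=
  match i with inl j => sinq X j.+1 | inr j => cosq X j.+1 end.

Let wavec n (s c : nat -> R) (i : 'I_n + 'I_n) : R :=
  match i with inl j => s j.+1 | inr j => c j.+1 end.

Let fourier_sumE s c n x :
  fourier_sum X s c n x = \sum_(i : 'I_n + 'I_n) wavec s c i * wave i x.
Proof. by rewrite big_sumType /fourier_sum big_add1 big_mkord big_split. Qed.

Lemma sqnorm2_fourier_sum s c n :
  sqnorm2 X nu (fourier_sum X s c n) = \sum_(1 <= q < n.+1) (s q ^+ 2 + c q ^+ 2).
Proof.
rewrite (funext (fourier_sumE s c n)) sqnorm2_orthonormal.
- by rewrite big_sumType big_add1 big_mkord big_split.
- by case=> j; [exact: continuous_sinq|exact: continuous_cosq].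
- move=> [i|i] [j|j] /=.
  + by rewrite Rintegral_sinq_sinq.
  + by rewrite Rintegral_sinq_cosq.
  + under eq_Rintegral do rewrite mulrC.
    by rewrite Rintegral_sinq_cosq.
  + by rewrite Rintegral_cosq_cosq.
Qed.

Lemma continuous_fourier_sum s c n : continuous (fourier_sum X s c n).
Proof.
rewrite (funext (fourier_sumE s c n)); apply: continuous_bigsum => -[j|j] x /=.
- by apply: cvgM; [exact: cvg_cst|exact: continuous_sinq].
- by apply: cvgM; [exact: cvg_cst|exact: continuous_cosq].
Qed.

End Parseval.

(** * Errors and risks in terms of coefficients *)

Section Model.
Context (R : realType) (X : R) (m : nat) (freq : 'I_m -> nat).
Hypotheses (freq_inj : injective freq) (freq_gt0 : forall j, (0 < freq j)%N).
Implicit Types (a : 'cV[R]_(m + m)) (n : nat).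

Definition model a (x : R) : R := ((features X freq x)^T *m a) 0 0.

(** Zero outside of the range of freq: these are the coefficients of a model
    seen as a trigonometric polynomial in all the frequencies. *)
Definition spread (v : 'cV[R]_m) (q : nat) : R := \sum_(j | freq j == q) v j 0.

Lemma spread_freq v j : spread v (freq j) = v j 0.
Proof.
by rewrite /spread (eq_bigl (pred1 j)) ?big_pred1_eq// => i; rewrite (inj_eq freq_inj).
Qed.

Lemma spread_notin v q : q \notin codom freq -> spread v q = 0.
Proof.
move=> qF; rewrite /spread big1// => j /eqP jq.
by rewrite -jq codom_f in qF.
Qed.

Lemma big_codom_freq n (F : nat -> R) : (forall j, freq j <= n)%N ->
  \sum_(1 <= q < n.+1 | q \in codom freq) F q = \sum_j F (freq j).
Proof.
move=> hn; rewrite -big_filter (perm_big (codom freq)); last first.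
  apply: uniq_perm; first by rewrite filter_uniq// iota_uniq.
    by rewrite map_inj_uniq ?enum_uniq.
  move=> q; rewrite mem_filter; case: codomP => //= -[j ->].
  by rewrite mem_index_iota freq_gt0 ltnS hn.
by rewrite /codom /image_mem big_map big_enum.
Qed.

Lemma modelE a x : model a x =
  \sum_j (usubmx a j 0 * sinq X (freq j) x + dsubmx a j 0 * cosq X (freq j) x).
Proof.
rewrite /model /features -[a in LHS]vsubmxK tr_col_mx mul_row_col mxE !mxE -big_split.
by apply: eq_bigr => j _; rewrite !mxE/= [in RHS]mulrC [X in _ = _ + X]mulrC.
Qed.

Lemma model_fourier_sum a n : (forall j, freq j <= n)%N ->
  model a = fourier_sum X (spread (usubmx a)) (spread (dsubmx a)) n.
Proof.
move=> hn; apply/funext => x; rewrite modelE /fourier_sum.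
rewrite (bigID (mem (codom freq)))/= [X in _ + X]big1 ?addr0; last first.
  by move=> q qF; rewrite !spread_notin// !mul0r addr0.
by rewrite big_codom_freq//; apply: eq_bigr => j _; rewrite !spread_freq.
Qed.

Lemma ex_freq_bound : exists n, forall j, (freq j <= n)%N.
Proof. by exists (\max_j freq j) => j; exact: leq_bigmax. Qed.

Lemma continuous_model a : continuous (model a).
Proof.
have [n hn] := ex_freq_bound; rewrite (model_fourier_sum a hn).
exact: continuous_fourier_sum.
Qed.

Context (nu : probability (measurableTypeR R) R).
Hypotheses (X0 : 0 < X) (nu_uniform : uniform_on_inputs X nu).

Lemma fourier_sumB s c s' c' n x :
  fourier_sum X s c n x - fourier_sum X s' c' n x =
  fourier_sum X (s \- s') (c \- c') n x.
Proof.
by rewrite /fourier_sum -sumrB; apply: eq_bigr => q _; rewrite /= !mulrBl; ring.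
Qed.

Lemma sqnorm2_model_fourier_sum a als alc n : (forall j, freq j <= n)%N ->
  sqnorm2 X nu (model a \- fourier_sum X als alc n) =
  \sum_i (a i 0 - coeffs als alc freq i 0) ^+ 2 +
  \sum_(1 <= q < n.+1 | q \notin codom freq) (als q ^+ 2 + alc q ^+ 2).
Proof.
move=> hn; rewrite (model_fourier_sum a hn).
rewrite (_ : _ \- _ = fourier_sum X (spread (usubmx a) \- als)
    (spread (dsubmx a) \- alc) n); last by apply/funext => x; exact: fourier_sumB.
rewrite sqnorm2_fourier_sum// (bigID (mem (codom freq)))/=; congr (_ + _).
  rewrite big_codom_freq// big_split_ord/= -big_split/=.
  apply: eq_bigr => j _; rewrite !spread_freq !mxE.
  by rewrite (unsplitK (inl j)) (unsplitK (inr j)) !mxE.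
by apply: eq_bigr => q qF; rewrite /= !spread_notin// !sub0r !sqrrN.
Qed.

Lemma sqnorm2_model a : sqnorm2 X nu (model a) = \sum_i a i 0 ^+ 2.
Proof.
have [n hn] := ex_freq_bound.
have := sqnorm2_model_fourier_sum a (fun=> 0) (fun=> 0) hn.
rewrite [X in _ + X]big1 ?addr0; last by move=> q _; rewrite expr0n/= addr0.
rewrite (_ : _ \- _ = model a); last first.
  apply/funext => x; rewrite /= /fourier_sum big1 ?subr0// => q _.
  by rewrite !mul0r addr0.
move=> ->; apply: eq_bigr => i _; congr (_ ^+ 2).
by rewrite /coeffs !mxE; case: (fintype.split i) => j; rewrite mxE subr0.
Qed.

(** By orthonormality, the coefficients of the zero function have a zero sum of
    squares. This makes the norm of the hypothesis space computable: the vector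
    chosen in its definition is any vector that represents the function. *)
Lemma represents_unique f a b :
  represents X freq f a -> represents X freq f b -> a = b.
Proof.
move=> fa fb; apply/colP => i; apply/eqP; rewrite -subr_eq0 -sqrf_eq0.
have E : sqnorm2 X nu (model (a - b)) = 0.
  rewrite -norm2_sqr (@eq_norm2 _ _ _ _ (cst 0)).
    by rewrite norm2_sqr /sqnorm2; under eq_Rintegral do rewrite expr0n/=;
      rewrite Rintegral_cst ?mul0r//; exact: measurable_inputs.
  by move=> x Dx; rewrite /model mulmxBr mxE [X in _ + X]mxE -fa// -fb// subrr.
move/eqP: E; rewrite sqnorm2_model psumr_eq0; last by move=> j _; exact: sqr_ge0.
by move/allP/(_ i); rewrite mem_index_enum !mxE => /(_ isT).
Qed.

Lemma hypothesis_sqnormE (lam : 'rV[R]_(m + m)) f a : (forall i, 0 < lam 0 i) ->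
  represents X freq f a ->
  hypothesis_sqnorm X freq lam f = \sum_i a i 0 ^+ 2 / lam 0 i.
Proof.
move=> lam0 fa; rewrite /hypothesis_sqnorm.
case: xgetP => [b _ fb|/(_ a)//].
rewrite -(represents_unique fa fb).
have -> : invmx (diag_mx lam) = diag_mx (\row_i (lam 0 i)^-1).
  have lamK : diag_mx lam *m diag_mx (\row_i (lam 0 i)^-1) = 1%:M.
    rewrite mulmx_diag; apply/matrixP => i j; rewrite !mxE divff//.
    by rewrite gt_eqF.
  have [ulam _] := mulmx1_unit lamK.
  by rewrite -[RHS](mulKmx ulam) lamK mulmx1.
rewrite -mulmxA mul_diag_mx mxE; apply: eq_bigr => i _; rewrite !mxE.
by rewrite mulrCA -expr2 mulrC.
Qed.

Context (f : R -> R) (als alc : nat -> R).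
Hypotheses (f_L2 : square_integrable X nu f)
  (sq_summable : cvgn (fun n => \sum_(1 <= q < n) (als q ^+ 2 + alc q ^+ 2)))
  (f_expansion : norm2 X nu (f \- fourier_sum X als alc n) @[n --> \oo] --> (0 : R)).

Definition off_model_energy : R := \big[+%R/0]_(1 <= q <oo | q \notin codom freq)
  (als q ^+ 2 + alc q ^+ 2).

Let term0 q : 0 <= als q ^+ 2 + alc q ^+ 2.
Proof. by rewrite addr_ge0 ?sqr_ge0. Qed.

Lemma cvg_off_model_energy :
  \sum_(1 <= q < n | q \notin codom freq) (als q ^+ 2 + alc q ^+ 2)
    @[n --> \oo] --> off_model_energy.
Proof.
have nd (P : pred nat) :
    nondecreasing_seq (fun n => \sum_(1 <= q < n | P q) (als q ^+ 2 + alc q ^+ 2)).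
  apply/nondecreasing_seqP => -[|n]; first by rewrite !big_geq.
  by rewrite big_mkcond [leRHS]big_mkcond [leRHS]big_nat_recr//= lerDl; case: ifP.
apply: (nondecreasing_is_cvgn (nd _)).
exists (limn (fun n => \sum_(1 <= q < n) (als q ^+ 2 + alc q ^+ 2))) => _ [n _ <-].
apply: le_trans (nondecreasing_cvgn_le (nd _) sq_summable n).
by rewrite big_mkcond/=; apply: ler_sum => q _; case: ifP.
Qed.

Lemma off_model_energy_ge0 : 0 <= off_model_energy.
Proof.
by apply: (limr_ge cvg_off_model_energy); apply: nearW => n; exact: sumr_ge0.
Qed.

(** Every partial Fourier sum of f that covers the chosen frequencies satisfies
    this identity with a partial sum of the energy at the other frequencies. *)
Lemma sqnorm2_modelB a : sqnorm2 X nu (model a \- f) =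
  \sum_i (a i 0 - coeffs als alc freq i 0) ^+ 2 + off_model_energy.
Proof.
have cvgl : sqnorm2 X nu (model a \- fourier_sum X als alc n) @[n --> \oo]
    --> sqnorm2 X nu (model a \- f).
  under eq_fun do rewrite -norm2_sqr expr2; rewrite -norm2_sqr expr2.
  suff cvgN : norm2 X nu (model a \- fourier_sum X als alc n) @[n --> \oo]
      --> norm2 X nu (model a \- f) by exact: cvgM.
  apply: cvg_norm2 => // [n|]; apply: continuous_square_integrable.
  - exact: continuous_fourier_sum.
  - exact: continuous_model.
have cvgr : sqnorm2 X nu (model a \- fourier_sum X als alc n) @[n --> \oo]
    --> \sum_i (a i 0 - coeffs als alc freq i 0) ^+ 2 + off_model_energy.
  have [N hN] := ex_freq_bound.
  have := cvg_off_model_energy; rewrite -cvg_shiftS => cvg_energyS.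
  apply: cvg_trans (cvgD (cvg_cst _) cvg_energyS).
  apply: near_eq_cvg; near=> n.
  rewrite /= sqnorm2_model_fourier_sum// => j.
  by rewrite (leq_trans (hN j))//; near: n; exact: nbhs_infty_ge.
exact: (cvg_unique _ cvgl cvgr).
Unshelve. all: by end_near. Qed.

Context (lam : 'rV[R]_(m + m)) (gam : R).
Hypotheses (lam_gt0 : forall i, 0 < lam 0 i) (gam_gt0 : 0 < gam).
Local Notation alpha := (coeffs als alc freq).

Lemma penalized_risk_represents g a : represents X freq g a ->
  penalized_risk X nu freq lam gam f g =
  \sum_i ((a i 0 - alpha i 0) ^+ 2 + gam * (a i 0 ^+ 2 / lam 0 i)) + off_model_energy.
Proof.
move=> ga; rewrite /penalized_risk (hypothesis_sqnormE lam_gt0 ga).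
rewrite -norm2_sqr (@eq_norm2 _ _ _ _ (model a \- f)); last first.
  by move=> x Dx /=; rewrite ga.
by rewrite norm2_sqr sqnorm2_modelB mulr_sumr big_split/= addrAC.
Qed.

(** Completing the square, the risk of a coefficient vector b exceeds the risk
    of the shrunk vector a by \sum_i (1 + gamma / lambda_i) (b_i - a_i)^2, so
    that a minimizer can only be a. *)
Lemma estimator_coeffs g b : represents X freq g b ->
  is_estimator X nu freq lam gam f g ->
  forall i, b i 0 = lam 0 i / (lam 0 i + gam) * alpha i 0.
Proof.
move=> gb [_ gmin].
pose a : 'cV[R]_(m + m) := \col_i (lam 0 i / (lam 0 i + gam) * alpha i 0).
have aE i : a i 0 = lam 0 i / (lam 0 i + gam) * alpha i 0 by rewrite [LHS]mxE.
have /gmin : hypothesis_space X freq (model a) by exists a.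
rewrite (penalized_risk_represents gb) (@penalized_risk_represents _ a)// lerD2r.
have n0 i : (lam 0 i != 0) * (lam 0 i + gam != 0).
  by rewrite !gt_eqF// addr_gt0.
rewrite -subr_le0 -sumrB.
under eq_bigr => i _.
  rewrite (_ : _ - _ = (1 + gam / lam 0 i) * (b i 0 - a i 0) ^+ 2); last first.
    by rewrite aE; field; rewrite !n0.
  over.
have ge0 i : 0 <= (1 + gam / lam 0 i) * (b i 0 - a i 0) ^+ 2.
  by rewrite mulr_ge0 ?sqr_ge0// addr_ge0// divr_ge0// ltW.
move=> le0 i; have : \sum_i (1 + gam / lam 0 i) * (b i 0 - a i 0) ^+ 2 == 0.
  by rewrite eq_le le0 sumr_ge0.
rewrite psumr_eq0// => /allP/(_ i); rewrite mem_index_enum => /(_ isT)/=.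
rewrite mulf_eq0 sqrf_eq0 subr_eq0 aE gt_eqF/=; first by move/eqP.
by rewrite addr_gt0// divr_gt0.
Qed.

Lemma norm2_estimatorB g : is_estimator X nu freq lam gam f g ->
  norm2 X nu (g \- f) =
  Num.sqrt (\sum_i (gam / (lam 0 i + gam) * alpha i 0) ^+ 2 + off_model_energy).
Proof.
move=> eg; have [[b gb] _] := eg.
rewrite (@eq_norm2 _ _ _ _ (model b \- f)); last by move=> x Dx /=; rewrite gb.
rewrite /norm2 sqnorm2_modelB; congr (Num.sqrt (_ + _)).
apply: eq_bigr => i _; rewrite (estimator_coeffs gb eg) -sqrrN; congr (_ ^+ 2).
by field; rewrite gt_eqF// addr_gt0.
Qed.

End Model.

(** * From the exact error to the two bounds *)

Section Bounds.
Context (R : realType).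

Lemma ler_sqrtD (x y : R) : 0 <= x -> 0 <= y ->
  Num.sqrt (x + y) <= Num.sqrt x + Num.sqrt y.
Proof.
move=> x0 y0; rewrite -[leRHS]ger0_norm ?addr_ge0 ?sqrtr_ge0// -sqrtr_sqr.
by rewrite ler_wsqrtr// sqrrD !sqr_sqrtr// addrAC lerDl mulrn_wge0// mulr_ge0 ?sqrtr_ge0.
Qed.

Lemma ler_euclid_sum n (v : 'cV[R]_n) : euclid v <= \sum_i `|v i 0|.
Proof.
have : forall r : seq 'I_n,
    Num.sqrt (\sum_(i <- r) v i 0 ^+ 2) <= \sum_(i <- r) `|v i 0|.
  elim=> [|i r IH]; first by rewrite !big_nil sqrtr0.
  rewrite !big_cons (le_trans (ler_sqrtD _ _))// ?sqr_ge0 ?sumr_ge0//.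
    by move=> j _; exact: sqr_ge0.
  by rewrite sqrtr_sqr lerD2l.
exact.
Qed.

Lemma ler_max_norm n (v : 'cV[R]_n) i : `|v i 0| <= max_norm v.
Proof. by rewrite /max_norm; exact: (le_bigmax_cond _ (fun i => `|v i 0|)). Qed.

End Bounds.

Theorem proposition1 (R : realType) (X : R) (hX : 0 < X)
  (rho : probability (measurableTypeR R * measurableTypeR R)%type R)
  (hrho : uniform_marginal X rho)
  (k : R.-pker measurableTypeR R ~> measurableTypeR R)
  (hk : conditional_distribution rho k)
  (hmean : has_conditional_mean X rho k)
  (hL2 : square_integrable X (marginal rho) (regression k))
  (als alc : nat -> R)
  (hsq : cvgn (fun n => \sum_(1 <= q < n) (als q ^+ 2 + alc q ^+ 2)))
  (hexp : norm2 X (marginal rho) (regression k \- fourier_sum X als alc n)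
            @[n --> \oo] --> (0 : R))
  (m : nat) (hm : (0 < m)%N)
  (freq : 'I_m -> nat) (hfreq : injective freq)
  (hfreq_gt0 : forall j, (0 < freq j)%N)
  (lam : 'rV[R]_(m + m)) (hlam : forall i, 0 < lam 0 i)
  (lmin : R) (hlmin : exists i, lmin = lam 0 i)
  (hlmin_le : forall i, lmin <= lam 0 i)
  (gam : R) (hgam : 0 < gam)
  (fH : R -> R)
  (hfH : is_estimator X (marginal rho) freq lam gam (regression k) fH) :
  norm2 X (marginal rho) (fH \- regression k)
    <= gam / (lmin + gam) * euclid (coeffs als alc freq)
       + Num.sqrt (\big[+%R/0]_(1 <= q <oo | q \notin codom freq)
                     (als q ^+ 2 + alc q ^+ 2))
  /\
  norm2 X (marginal rho) (fH \- regression k)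
    <= max_norm (coeffs als alc freq) * gam * (\sum_i (lam 0 i)^-1)
       + Num.sqrt (\big[+%R/0]_(1 <= q <oo | q \notin codom freq)
                     (als q ^+ 2 + alc q ^+ 2)).
Proof.
have nu_uniform : uniform_on_inputs X (marginal rho) := hrho.
rewrite (norm2_estimatorB hfreq hfreq_gt0 hX nu_uniform hL2 hsq hexp hlam hgam hfH).
rewrite -/(off_model_energy freq als alc).
set alpha := coeffs als alc freq.
have lmin0 : 0 < lmin by case: hlmin => i ->.
pose shrunk : 'cV[R]_(m + m) := \col_i (gam / (lam 0 i + gam) * alpha i 0).
have shrunkE i : shrunk i 0 = gam / (lam 0 i + gam) * alpha i 0 by rewrite [LHS]mxE.
have -> : \sum_i (gam / (lam 0 i + gam) * alpha i 0) ^+ 2 = \sum_i shrunk i 0 ^+ 2.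
  by apply: eq_bigr => i _; rewrite shrunkE.
have sqrt_le : Num.sqrt (\sum_i shrunk i 0 ^+ 2 + off_model_energy freq als alc) <=
    euclid shrunk + Num.sqrt (off_model_energy freq als alc).
  rewrite ler_sqrtD ?off_model_energy_ge0//; apply: sumr_ge0 => i _; exact: sqr_ge0.
split; apply: (le_trans sqrt_le); rewrite lerD2r.
- have c0 : 0 <= gam / (lmin + gam) by rewrite divr_ge0 ?addr_ge0 ?ltW.
  rewrite /euclid -[X in X * _]ger0_norm// -sqrtr_sqr -sqrtrM ?sqr_ge0//.
  rewrite ler_wsqrtr// mulr_sumr; apply: ler_sum => i _.
  rewrite shrunkE exprMn ler_wpM2r ?sqr_ge0// lerXn2r ?nnegrE//.
    by rewrite divr_ge0 ?addr_ge0 ?ltW.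
  by rewrite ler_wpM2l ?(ltW hgam)// lef_pV2 ?posrE ?addr_gt0// lerD2r.
- apply: (le_trans (ler_euclid_sum _)); rewrite mulr_sumr; apply: ler_sum => i _.
  have c0 : 0 <= gam / (lam 0 i + gam) by rewrite divr_ge0 ?addr_ge0 ?ltW.
  rewrite shrunkE normrM ger0_norm// mulrC -mulrA ler_pM ?normr_ge0 ?ler_max_norm//.
  by rewrite ler_wpM2l ?(ltW hgam)// lef_pV2 ?posrE ?addr_gt0// lerDl ltW.
Qed.
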